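(* Let $X\subset\mathbb{R}^2$ be a non-empty finite set equipped with the restriction of the Manhattan metric $d_1$, and for $x\in X$ let $m_x\in\mathbb{R}^2$ be the metric center of $x$. Let $(t(X),d^1)$ be the metric space obtained by trimming $(X,d_1)$, and let $m(X)\subset\mathbb{R}^2$ be the metric center of $X$. Then the map $$f:(t(X),d^1)\to (m(X),d_1),\qquad \overline{x}\mapsto m_x,$$ is an isometry.
   Context: The Manhattan metric on $\mathbb{R}^2$ is $d_1((x_1,y_1),(x_2,y_2))=|x_1-x_2|+|y_1-y_2|$. An isometry means a distance-preserving bijection. Trimming. Let $(X,d)$ be a non-empty finite metric space. If $|X|\ge 3$, the pendant length of $x\in X$ is $$\underline{d}(x)=\min_{\substack{y,z\in X\setminus\{x\}\\ y\neq z}} \triangle_{x,yz},\qquad \triangle_{x,yz}=\frac{d(x,y)+d(x,z)-d(y,z)}{2}$$ (the Gromov product at $x$ with respect to $y$ and $z$). Define an equivalence relation $\Re$ on $X$ by: $x\,\Re\, y$ if and only if $x=y$ or $d(x,y)=\underline{d}(x)+\underline{d}(y)$. Then $t(X)=X/\Re$ is the set of equivalence classes $\overline{x}$, with the metric $d^1$ given for distinct classes by $d^1(\overline{x},\overline{y})=d(x,y)-\underline{d}(x)-\underline{d}(y)$ (and $d^1(\overline{x},\overline{x})=0$). If $|X|=1$ or $|X|=2$, $t(X)$ is defined to be a one-point space, and $\overline{x}$ denotes its unique point for every $x\in X$. Metric centers. For $a,b,c\in\mathbb{R}^2$, the metric center $m(a,b,c)$ is the unique point $m\in\mathbb{R}^2$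 with $d_1(a,b)=d_1(a,m)+d_1(m,b)$, $d_1(a,c)=d_1(a,m)+d_1(m,c)$ and $d_1(b,c)=d_1(b,m)+d_1(m,c)$. Let $X\subset\mathbb{R}^2$ be finite with the metric $d_1$. If $|X|\ge 3$ and $a\in X$, choose distinct $b,c\in X\setminus\{a\}$ for which the Gromov product $\triangle_{a,bc}$ (computed with $d_1$) is minimal among all such pairs; the metric center of $a$ is $m_a=m(a,b,c)$ (it does not depend on the choice of the minimizing pair). The metric center of $X$ is the set $m(X)=\{m_a: a\in X\}$. If $X=\{a,b\}$ has two points, $m(X)=\{\frac{a+b}{2}\}$ and $m_a=m_b=\frac{a+b}{2}$; if $X=\{a\}$, $m(X)=X$ and $m_a=a$. *)

(* Defs.v *)
From HB Require Import structures.
From mathcomp Require Import all_boot all_order all_algebra finmap lra.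
From mathcomp Require Import all_classical reals.

Set Implicit Arguments.
Unset Strict Implicit.
Unset Printing Implicit Defensive.

Import Order.TTheory GRing.Theory Num.Theory.
Local Open Scope ring_scope.

(* A metric is carried as a bare function: the metric structure of
   mathcomp-analysis also bundles a topology, of no use for finite spaces. *)
Definition gromov (R : realType) (T : Type) (d : T -> T -> R) (x y z : T) : R :=
  (d x y + d x z - d y z) / 2.

Definition metric_isometry (R : realType) (U V : Type) (A : set U) (dA : U -> U -> R)
    (B : set V) (dB : V -> V -> R) (f : U -> V) : Prop :=
  set_bij A B f /\
  (forall u v, A u -> A v -> dB (f u) (f v) = dA u v).

Section Trimming.
Variables (R : realType) (T : finType) (d : T -> T -> R).

Definition admissible (x : T) (p : T * T) : bool :=
  [&& p.1 != x, p.2 != x & p.1 != p.2].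

Definition minimal_pair (x y z : T) : Prop :=
  admissible x (y, z) /\
  (forall y' z', admissible x (y', z') -> gromov d x y z <= gromov d x y' z').

(* The value 0 is returned only when there is no admissible pair, that is,
   when the space has at most two points. *)
Definition pendant (x : T) : R :=
  if [pick p | admissible x p] is Some p0 then
    let p := [arg min_(p < p0 | admissible x p) gromov d x p.1 p.2]%O in
    gromov d x p.1 p.2
  else 0.

(* The first alternative makes the quotient of a space with one or two points
   a one-point space. *)
Definition trim_rel (x y : T) : bool :=
  [|| (#|T| <= 2)%N, x == y | d x y == pendant x + pendant y].

Definition trim_class (x : T) : {set T} := [set y | trim_rel x y].

Definition trimming : {set {set T}} := [set trim_class x | x : T].

(* The distance is read off on arbitrary representatives;
   see trim_dist_class for the independence of their choice. *)
Definition trim_dist (C D : {set T}) : R :=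
  if C == D then 0 else
  match [pick x in C], [pick y in D] with
  | Some x, Some y => d x y - pendant x - pendant y
  | _, _ => 0
  end.

Lemma admissible_exists x : (2 < #|T|)%N -> exists p, admissible x p.
Proof.
move=> T3; have : (1 < #|[set~ x]|)%N by rewrite cardsC1; case: #|T| T3.
case/card_gt1P=> y [z] []; rewrite !inE => yx zx yz.
by exists (y, z); rewrite /admissible yx zx yz.
Qed.

Lemma pendantP x : (2 < #|T|)%N ->
  exists y z, minimal_pair x y z /\ pendant x = gromov d x y z.
Proof.
move=> /(admissible_exists x) [p0 p0P]; rewrite /pendant.
case: pickP => [p1 p1P|/(_ p0)]; last by rewrite p0P.
case: arg_minP => //= -[y z] yzP yz_min; exists y, z; split => //.
by split=> // y' z' /(yz_min (y', z')).
Qed.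

Lemma pendant_minimal x y z : minimal_pair x y z -> pendant x = gromov d x y z.
Proof.
move=> [yzP yz_min]; rewrite /pendant.
case: pickP => [p1 p1P|/(_ (y, z))]; last by rewrite yzP.
case: arg_minP => //= -[y' z'] /= yzP' /(_ _ yzP) /= le1.
by apply/le_anti; rewrite le1 yz_min.
Qed.

Lemma pendant_le x y z : admissible x (y, z) -> pendant x <= gromov d x y z.
Proof.
move=> yzP; rewrite /pendant.
case: pickP => [p1 p1P|/(_ (y, z))]; last by rewrite yzP.
by case: arg_minP => //= p _ /(_ _ yzP).
Qed.

Hypothesis d_sym : forall x y, d x y = d y x.

Lemma trim_rel_shift x x' y : (2 < #|T|)%N -> trim_rel x x' ->
  y != x -> y != x' -> d x y - pendant x = d x' y - pendant x'.
Proof.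
move=> T3; rewrite /trim_rel leqNgt T3 /= => /predU1P[->//|/eqP dE] yx yx'.
have [->//|xx'] := eqVneq x x'.
have A1 : admissible x (x', y) by rewrite /admissible /= (eq_sym x' x) xx' yx eq_sym.
have A2 : admissible x' (x, y) by rewrite /admissible /= xx' yx' eq_sym.
have := pendant_le A1; have := pendant_le A2.
rewrite /gromov (d_sym x' x) => h1 h2; lra.
Qed.

Lemma trim_rel_equiv : equivalence_rel trim_rel.
Proof.
have sym x y : trim_rel x y = trim_rel y x.
  by rewrite /trim_rel eq_sym d_sym addrC.
have refl x : trim_rel x x by rewrite /trim_rel eqxx orbT.
have tr x y z : trim_rel x y -> trim_rel y z -> trim_rel x z.
  have [T2|T3] := leqP #|T| 2; first by rewrite /trim_rel T2.
  move=> xy yz; have [<-//|xz] := eqVneq x z.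
  have [zy|zy] := eqVneq z y; first by rewrite zy.
  have zx : z != x by rewrite eq_sym.
  have h := trim_rel_shift T3 xy zx zy.
  move: yz; rewrite /trim_rel leqNgt T3 /= (eq_sym y) (negbTE zy) (negbTE xz) /=.
  by move=> /eqP yz; apply/eqP; lra.
move=> x y z; split=> [|xy]; first exact: refl.
by apply/idP/idP; apply: tr => //; rewrite sym.
Qed.

Lemma trim_classE x y : (trim_class x == trim_class y) = trim_rel x y.
Proof.
have E := trim_rel_equiv; apply/eqP/idP => [|xy].
  move=> /setP /(_ y); rewrite !inE => ->; exact: (E y y y).1.
by apply/setP => z; rewrite !inE; exact: (E x y z).2.
Qed.

Lemma trim_dist_class x y : trim_class x != trim_class y ->
  trim_dist (trim_class x) (trim_class y) = d x y - pendant x - pendant y.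
Proof.
move=> nxy; rewrite /trim_dist (negbTE nxy).
have E := trim_rel_equiv.
case: pickP => [x'|/(_ x)]; last by rewrite inE (E x x x).1.
case: pickP => [y'|/(_ y)]; last by rewrite inE (E y y y).1.
move: nxy; rewrite trim_classE !inE => nxy yy' xx'.
have T3 : (2 < #|T|)%N by rewrite ltnNge; apply: contra nxy; rewrite /trim_rel => ->.
have nx'y : ~~ trim_rel x' y by rewrite -(E x x' y).2.
have nyx' : ~~ trim_rel y x'.
  by move: nx'y; rewrite /trim_rel eq_sym d_sym addrC.
have ny'x' : ~~ trim_rel y' x' by rewrite -(E y y' x').2.
have ne u v : ~~ trim_rel u v -> u != v.
  by apply: contra => /eqP ->; exact: (E v v v).1.
have yx : y != x by rewrite eq_sym ne.
have h1 := trim_rel_shift T3 xx' yx (ne _ _ nyx').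
have x'y' : x' != y' by rewrite eq_sym ne.
have := trim_rel_shift T3 yy' (ne _ _ nx'y) x'y'.
by rewrite !(d_sym _ x') => h2; lra.
Qed.

End Trimming.

Section MetricCenter.
Variable R : realType.
Implicit Types (a b c m : R * R) (X : {fset R * R}).

Definition d1 a b : R := `|a.1 - b.1| + `|a.2 - b.2|.

Definition is_center3 a b c m : Prop :=
  [/\ d1 a b = d1 a m + d1 m b, d1 a c = d1 a m + d1 m c &
      d1 b c = d1 b m + d1 m c].

(* xget picks the unique point satisfying is_center3, see center3_exists and
   center3_unique. *)
Definition center3 a b c : R * R := xget (0, 0) (is_center3 a b c).

Definition dist_on X (x y : X) : R := d1 (val x) (val y).

(* "m is a metric center of a in X"; such an m exists and is unique,
   see is_metric_center_exists and is_metric_center_unique. *)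
Definition is_metric_center X (a : X) m : Prop :=
  match #|{: X}| with
  | 1%N => m = val a
  | 2%N => exists2 b : X, b != a &
      m = (((val a).1 + (val b).1) / 2, ((val a).2 + (val b).2) / 2)
  | _ => exists b c : X, minimal_pair (@dist_on X) a b c /\
      m = center3 (val a) (val b) (val c)
  end.

Definition metric_center X (a : X) : R * R := xget (val a) (is_metric_center a).

Definition metric_center_set X : set (R * R) := range (@metric_center X).

Let d1_sym a b : d1 a b = d1 b a.
Proof. by rewrite /d1 distrC [X in _ + X]distrC. Qed.

(* Coordinatewise, the metric center is the median. *)
Let median_exists (a b c : R) : exists m : R,
  [/\ `|a - b| = `|a - m| + `|m - b|, `|a - c| = `|a - m| + `|m - c| &
      `|b - c| = `|b - m| + `|m - c|].
Proof.
have btw (x m y : R) : (x <= m <= y) || (y <= m <= x) ->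
    `|x - y| = `|x - m| + `|m - y|.
  by case: (ger0P (x - y)); case: (ger0P (x - m)); case: (ger0P (m - y)); lra.
case: (leP a b) => ab; case: (leP a c) => ac; case: (leP b c) => bc;
  (by exists a; split; apply: btw; lra) || (by exists b; split; apply: btw; lra)
  || (by exists c; split; apply: btw; lra).
Qed.

Lemma center3_exists a b c : exists m, is_center3 a b c m.
Proof.
have [mx [x1 x2 x3]] := median_exists a.1 b.1 c.1.
have [my [y1 y2 y3]] := median_exists a.2 b.2 c.2.
by exists (mx, my); split; rewrite /d1 /=; lra.
Qed.

Let d1_split a b m : d1 a b = d1 a m + d1 m b ->
  `|a.1 - b.1| = `|a.1 - m.1| + `|m.1 - b.1| /\
  `|a.2 - b.2| = `|a.2 - m.2| + `|m.2 - b.2|.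
Proof.
have := ler_distD m.1 a.1 b.1; have := ler_distD m.2 a.2 b.2.
by rewrite /d1 => h1 h2 h3; split; lra.
Qed.

Let between (x t y : R) : `|x - y| = `|x - t| + `|t - y| ->
  (x <= t <= y) || (y <= t <= x).
Proof.
by case: (ger0P (x - y)); case: (ger0P (x - t)); case: (ger0P (t - y)); lra.
Qed.

Let median_eq (a b c m : R) :
  `|a - b| = `|a - m| + `|m - b| -> `|a - c| = `|a - m| + `|m - c| ->
  `|b - c| = `|b - m| + `|m - c| -> [\/ m = b, m = c | m = a].
Proof.
move=> /between B1 /between B2 /between B3.
have [?|mb] := eqVneq m b; first by constructor 1.
have [?|mc] := eqVneq m c; first by constructor 2.
by constructor 3; move: mb mc; rewrite !neq_lt => /orP[] mb /orP[] mc; lra.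
Qed.

Let reach3 (a b c m n : R) :
  `|a - b| = `|a - m| + `|m - b| -> `|a - c| = `|a - m| + `|m - c| ->
  `|b - c| = `|b - m| + `|m - c| -> `|a - b| = `|a - n| + `|n - b| ->
  `|a - c| = `|a - n| + `|n - c| -> `|a - m| = `|a - n| + `|n - m|.
Proof.
move=> m1 m2 m3 n1 n2; case: (median_eq m1 m2 m3) => E; rewrite ?E //.
have := ler_distD n b c; rewrite E (distrC b a) in m3.
have := normr_ge0 (a - n); rewrite (distrC n a) (distrC b n) subrr normr0; lra.
Qed.

Let median_unique (a b c m n : R) :
  `|a - b| = `|a - m| + `|m - b| -> `|a - c| = `|a - m| + `|m - c| ->
  `|b - c| = `|b - m| + `|m - c| ->
  `|a - b| = `|a - n| + `|n - b| -> `|a - c| = `|a - n| + `|n - c| ->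
  `|b - c| = `|b - n| + `|n - c| -> m = n.
Proof.
move=> m1 m2 m3 n1 n2 n3; have := reach3 m1 m2 m3 n1 n2.
rewrite (distrC b m) in m3; rewrite (distrC b n) in n3 => h.
by apply/esym/eqP; rewrite -subr_eq0 -normr_eq0; apply/eqP; lra.
Qed.

Lemma center3_unique a b c m n :
  is_center3 a b c m -> is_center3 a b c n -> m = n.
Proof.
move=> [/d1_split[a1 a2] /d1_split[b1 b2] /d1_split[c1 c2]].
move=> [/d1_split[x1 x2] /d1_split[y1 y2] /d1_split[z1 z2]].
rewrite [m]surjective_pairing [n]surjective_pairing; congr pair.
  exact: (median_unique a1 b1 c1 x1 y1 z1).
exact: (median_unique a2 b2 c2 x2 y2 z2).
Qed.

Lemma center3P a b c : is_center3 a b c (center3 a b c).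
Proof. exact: (@xgetPex _ _ (is_center3 a b c)) (center3_exists a b c). Qed.

Lemma is_metric_center_exists X (a : X) : exists m, is_metric_center a m.
Proof.
rewrite /is_metric_center; case E : #|_| => [|[|[|n]]].
- by have := fintype0 a; rewrite E.
- by exists (val a).
- have : (0 < #|[set~ a]|)%N by rewrite cardsC1 E.
  case/card_gt0P => b; rewrite !inE => ba.
  by eexists; exists b.
- have [|b [c [bc _]]] := @pendantP _ _ (@dist_on X) a; first by rewrite E.
  by exists (center3 (val a) (val b) (val c)), b, c.
Qed.

Let reach1 (a b m z : R) : `|a - b| = `|a - m| + `|m - b| ->
  `|a - b| + `|a - z| - `|b - z| < 2 * `|a - m| \/
  `|a - z| = `|a - m| + `|m - z|.
Proof.
case: (ger0P (a - b)); case: (ger0P (a - m)); case: (ger0P (m - b));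
  case: (ger0P (a - z)); case: (ger0P (b - z)); case: (ger0P (m - z)); lra.
Qed.

Let reach2 (a b c m z : R) : `|a - b| = `|a - m| + `|m - b| ->
  `|a - c| = `|a - m| + `|m - c| -> `|b - c| = `|b - m| + `|m - c| ->
  `|a - b| + `|a - z| - `|b - z| <= 2 * `|a - m| \/
  `|a - c| + `|a - z| - `|c - z| <= 2 * `|a - m|.
Proof.
move=> m1 m2 m3; have := median_eq m1 m2 m3.
have tri := ler_distD m a z.
case=> E; rewrite -?E; [left; lra|right; lra|].
rewrite E subrr normr0 mulr0; move: (between m3); rewrite E.
case: (leP a z) => az /orP[]/andP[ba ac].
- left; rewrite (ger0_norm (x := a - b)) ?subr_ge0 //
    (ler0_norm (x := a - z)) ?subr_le0 //.
  rewrite (ler0_norm (x := b - z)); lra.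
- right; rewrite (ger0_norm (x := a - c)) ?subr_ge0 //
    (ler0_norm (x := a - z)) ?subr_le0 //.
  rewrite (ler0_norm (x := c - z)); lra.
- right; rewrite (ler0_norm (x := a - c)) ?subr_le0 //
    (gtr0_norm (x := a - z)) ?subr_gt0 //.
  rewrite (ger0_norm (x := c - z)); lra.
- left; rewrite (ler0_norm (x := a - b)) ?subr_le0 //
    (gtr0_norm (x := a - z)) ?subr_gt0 //.
  rewrite (ger0_norm (x := b - z)); lra.
Qed.

Let gate0 a b c z m : is_center3 a b c m ->
  2 * d1 a m <= d1 a b + d1 a z - d1 b z ->
  2 * d1 a m <= d1 a c + d1 a z - d1 c z -> d1 a z = d1 a m + d1 m z.
Proof.
move=> [/d1_split[ab1 ab2] /d1_split[ac1 ac2] /d1_split[bc1 bc2]] Hb Hc.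
have r1 := reach2 z.1 ab1 ac1 bc1; have r2 := reach2 z.2 ab2 ac2 bc2.
have {ab1} b1 := reach1 z.1 ab1; have {ab2} b2 := reach1 z.2 ab2.
have {ac1} c1 := reach1 z.1 ac1; have {ac2} c2 := reach1 z.2 ac2.
move: Hb Hc r1 r2 b1 b2 c1 c2; rewrite /d1 {bc1 bc2}.
move: (`|a.1 - b.1|) (`|a.2 - b.2|) (`|a.1 - c.1|) (`|a.2 - c.2|) => ab1 ab2 ac1 ac2.
move: (`|b.1 - z.1|) (`|b.2 - z.2|) (`|c.1 - z.1|) (`|c.2 - z.2|) => bz1 bz2 cz1 cz2.
move: (`|a.1 - z.1|) (`|a.2 - z.2|) (`|m.1 - z.1|) (`|m.2 - z.2|) => az1 az2 mz1 mz2.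
move: (`|a.1 - m.1|) (`|a.2 - m.2|) => am1 am2 Hb Hc r1 r2.
move=> [b1|->] [b2|->] [c1|e1] [c2|e2]; try lra.
all: by case: r1 => r1; case: r2 => r2; lra.
Qed.

Let gate X (a b c z : X) m : minimal_pair (@dist_on X) a b c ->
  is_center3 (val a) (val b) (val c) m -> z != a ->
  d1 (val a) (val z) = d1 (val a) m + d1 m (val z).
Proof.
move=> [bcP bc_min] C za; have [ab ac bc] := C.
have [->//|zb] := eqVneq z b; have [->//|zc] := eqVneq z c.
have /and3P[/= ba ca _] := bcP.
have [bz cz] : admissible a (b, z) /\ admissible a (c, z).
  by rewrite /admissible /= ba ca za !(eq_sym _ z) zb zc.
move: (bc_min _ _ bz) (bc_min _ _ cz); rewrite /gromov /dist_on.
have -> : d1 (val a) (val b) + d1 (val a) (val c) - d1 (val b) (val c)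
    = 2 * d1 (val a) m by rewrite ab ac bc (d1_sym (val b)); lra.
by move=> Hb Hc; apply: (gate0 C); lra.
Qed.

Lemma is_metric_center_unique X (a : X) m n : is_metric_center a m -> is_metric_center a n -> m = n.
Proof.
rewrite /is_metric_center; case E : #|_| => [|[|[|k]]]; last 1 first.
- move=> [b [c [bcM ->]]] [b' [c' [bcM' ->]]].
  have [ab ac bc] := center3P (val a) (val b) (val c).
  have C' := center3P (val a) (val b') (val c').
  set m' := center3 _ _ _ in ab ac bc *; set n' := center3 _ _ _ in C' *.
  have [/and3P[/= ba ca _] _] := bcM.
  have [ab1 ab2] := d1_split ab; have [ac1 ac2] := d1_split ac.
  have [bc1 bc2] := d1_split bc.
  have [ab1' ab2'] := d1_split (gate bcM' C' ba).
  have [ac1' ac2'] := d1_split (gate bcM' C' ca).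
  have h1 := reach3 ab1 ac1 bc1 ab1' ac1'.
  have h2 := reach3 ab2 ac2 bc2 ab2' ac2'.
  have e1 : d1 (val a) m' = pendant (@dist_on X) a.
    by rewrite (pendant_minimal bcM) /gromov /dist_on ab ac bc (d1_sym m'); lra.
  have e2 : d1 (val a) n' = pendant (@dist_on X) a.
    case: C' => ab' ac' bc'.
    by rewrite (pendant_minimal bcM') /gromov /dist_on ab' ac' bc' (d1_sym n'); lra.
  move: e1; rewrite -e2 /d1 h1 h2 => e.
  have p1 := normr_ge0 (n'.1 - m'.1); have p2 := normr_ge0 (n'.2 - m'.2).
  rewrite [m']surjective_pairing [n']surjective_pairing; congr pair.
    by apply/esym/eqP; rewrite -subr_eq0 -normr_eq0; apply/eqP; lra.
  by apply/esym/eqP; rewrite -subr_eq0 -normr_eq0; apply/eqP; lra.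
- by have := fintype0 a; rewrite E.
- by move=> -> ->.
- move=> [b ba ->] [c ca ->].
  have [->//|bc] := eqVneq b c.
  have : (1 < #|[set~ a]|)%N.
    by apply/card_gt1P; exists b, c; rewrite !inE.
  by rewrite cardsC1 E.
Qed.

Lemma metric_centerP X (a : X) : is_metric_center a (metric_center a).
Proof. exact: (@xgetPex _ _ (is_metric_center a)) (is_metric_center_exists a). Qed.

End MetricCenter.

(* Main.v *)
Require Import Defs.
From mathcomp Require Import all_boot all_order all_algebra finmap lra.
From mathcomp Require Import all_classical reals.

(** Write p(x) for the pendant length of x.  Everything follows from one
    identity, valid as soon as X has three points (dist_via_centers):

      d1 x y = p(x) + d1 m_x m_y + p(y)    for all distinct x, y in X.

    It says at once that m_x = m_y exactly when x and y are identified by the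
    trimming, and that otherwise the trimmed distance of their classes is
    d1 m_x m_y.

    The identity rests on a gate property of the Manhattan plane (gate): if m is
    the metric center of a, b, c, and if neither b nor c can be replaced by z
    to give a Gromov product at a smaller than d1 a m, then m lies on a geodesic
    from a to z.  Here d1 a m is the Gromov product of b and c at a, so for a
    minimizing pair d1 x m_x = p(x), and the gate property applies to every
    z in X other than x: it gives d1 x y = p(x) + d1 m_x y.  It applies a second
    time, at y, with the plane point m_x in the role of z: moving z from x to
    m_x shortens its distance to each point of X other than x by the same
    amount p(x), hence does not change the Gromov products at y with these
    points, and the Gromov product of x and m_x at y is d1 x y - p(x), which is
    at least p(y).  This gives d1 y m_x = p(y) + d1 m_y m_x.

    With at most two points, both the trimming and the metric center are a
    single point. *)

Set Implicit Arguments.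
Unset Strict Implicit.
Unset Printing Implicit Defensive.

Import Order.TTheory GRing.Theory Num.Theory.
Local Open Scope ring_scope.

Section Plane.
Variable R : realType.
Implicit Types a b c m z : R * R.

Lemma d1_sym a b : d1 a b = d1 b a.
Proof. by rewrite /d1 distrC [X in _ + X]distrC. Qed.

Lemma d1xx a : d1 a a = 0.
Proof. by rewrite /d1 !subrr normr0 addr0. Qed.

Lemma d1_ge0 a b : 0 <= d1 a b.
Proof. by rewrite /d1 addr_ge0. Qed.

Lemma d1_eq0 a b : d1 a b = 0 -> a = b.
Proof.
move/eqP; rewrite /d1 paddr_eq0 // !normr_eq0 !subr_eq0.
by case: a b => [a1 a2] [b1 b2] /= /andP[/eqP -> /eqP ->].
Qed.

Lemma d1_geodesic a b m : d1 a b = d1 a m + d1 m b ->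
  `|a.1 - b.1| = `|a.1 - m.1| + `|m.1 - b.1| /\
  `|a.2 - b.2| = `|a.2 - m.2| + `|m.2 - b.2|.
Proof.
have := ler_distD m.1 a.1 b.1; have := ler_distD m.2 a.2 b.2.
by rewrite /d1 => h1 h2 h3; split; lra.
Qed.

Lemma dist_betweenP (x t y : R) :
  `|x - y| = `|x - t| + `|t - y| <-> (x <= t <= y) || (y <= t <= x).
Proof.
by split; case: (ger0P (x - y)); case: (ger0P (x - t)); case: (ger0P (t - y));
  lra.
Qed.

(** On the line, e is the detour made by passing through the median m on the way
    from a to z, and f b is twice the amount by which |a - m| exceeds the
    Gromov product of b and z at a.  If e is not 0, then z lies on the same
    side of m as a, so b and c lie on the other side and f b = f c = e; if
    e = 0, then m separates z from b or from c, whose f is then 0.  The disjunction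
    is shaped so that a coordinate with e > 0 cannot be compensated for both b
    and c by the other coordinate. *)
Lemma median_detour (a b c m z : R) :
    `|a - b| = `|a - m| + `|m - b| -> `|a - c| = `|a - m| + `|m - c| ->
    `|b - c| = `|b - m| + `|m - c| ->
  let e := `|a - m| + `|m - z| - `|a - z| in
  let f u := 2 * `|a - m| - (`|a - u| + `|a - z| - `|u - z|) in
  [\/ e <= f b /\ e <= f c, e = 0 /\ 0 <= f b | e = 0 /\ 0 <= f c].
Proof.
move=> ab ac bc e f; rewrite {}/f ab ac.
have [e0|eN0] := eqVneq e 0.
  have [zb|zc] : `|z - b| = `|z - m| + `|m - b| \/
                 `|z - c| = `|z - m| + `|m - c|.
    case/dist_betweenP/orP: bc => /andP[h1 h2]; have [zm|mz] := leP z m;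
      by [left; apply/dist_betweenP; lra | right; apply/dist_betweenP; lra].
  - by constructor 2; move: e0; rewrite /e (distrC b z) zb (distrC z m); split; lra.
  - by constructor 3; move: e0; rewrite /e (distrC c z) zc (distrC z m); split; lra.
have beyond u : `|a - u| = `|a - m| + `|m - u| ->
    `|z - u| = `|z - m| + `|m - u|.
  move=> /dist_betweenP amu; apply/dist_betweenP.
  have : ~~ ((a <= m <= z) || (z <= m <= a)).
    by apply: contra eN0 => /dist_betweenP h; rewrite /e h subrr.
  lra.
by constructor 1; rewrite /e (distrC b) (distrC c) (beyond b ab) (beyond c ac)
  (distrC z m); split; lra.
Qed.

Lemma gate a b c m z : is_center3 a b c m ->
    d1 a m <= gromov (@d1 R) a b z -> d1 a m <= gromov (@d1 R) a c z ->
  d1 a z = d1 a m + d1 m z.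
Proof.
move=> [/d1_geodesic[ab1 ab2] /d1_geodesic[ac1 ac2] /d1_geodesic[bc1 bc2]].
have := median_detour z.1 ab1 ac1 bc1; have := median_detour z.2 ab2 ac2 bc2.
have := ler_distD m.1 a.1 z.1; have := ler_distD m.2 a.2 z.2.
rewrite /gromov /d1 /=.
by move=> t2 t1 [] [p2 q2] [] [p1 q1]; lra.
Qed.

Lemma center3_gromov a b c m : is_center3 a b c m ->
  gromov (@d1 R) a b c = d1 a m.
Proof. by case=> ab ac bc; rewrite /gromov ab ac bc (d1_sym b m); lra. Qed.

End Plane.

Section MetricCenterOfSet.
Variables (R : realType) (X : {fset R * R}).
Implicit Types x y z w : X.
Local Notation p := (pendant (@dist_on R X)).

Lemma dist_on_sym x y : dist_on x y = dist_on y x.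
Proof. exact: d1_sym. Qed.

Section ThreePoints.
Hypothesis X3 : (2 < #|{: X}|)%N.

Lemma metric_center_pair x : exists b c,
  minimal_pair (@dist_on R X) x b c /\
  is_center3 (val x) (val b) (val c) (metric_center x).
Proof.
have := metric_centerP x; rewrite /is_metric_center.
case: #|_| X3 => [|[|[|n]]] // _ [b [c [bcP ->]]].
by exists b, c; split; last exact: center3P.
Qed.

Lemma pendant_center x : p x = d1 (val x) (metric_center x).
Proof.
have [b [c [bcP C]]] := metric_center_pair x.
by rewrite (pendant_minimal bcP) -(center3_gromov C).
Qed.

(** A third point z makes the Gromov products at x and y add up to the
    distance of x and y. *)
Lemma pendant_add_le x y : x != y -> p x + p y <= dist_on x y.
Proof.
move=> xy; have : (0 < #|[set~ x] :\ y|)%N.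
  have : (1 < #|[set~ x]|)%N by rewrite cardsC1; case: #|{: X}| X3.
  by rewrite (cardsD1 y) !inE eq_sym xy.
case/card_gt0P=> z; rewrite !inE => /andP[zy zx].
have px : p x <= gromov (@dist_on R X) x y z.
  by apply: pendant_le; rewrite /admissible /= eq_sym xy zx eq_sym.
have py : p y <= gromov (@dist_on R X) y x z.
  by apply: pendant_le; rewrite /admissible /= xy zy eq_sym.
move: px py; rewrite /gromov (dist_on_sym y x).
(* Pendant lengths are generalized before calling lra, which would otherwise
   unfold them to compare its atoms. *)
by move: (p x) (p y) => px py; lra.
Qed.

(** The gate property for a minimizing pair.  The point z ranges over the whole
    plane, because it is used below both for points of X and for centers of
    other points. *)
Lemma center_geodesic x (z : R * R) :
    (forall w, w != x -> p x <= gromov (@d1 R) (val x) (val w) z) ->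
  d1 (val x) z = p x + d1 (metric_center x) z.
Proof.
have [b [c [[/and3P[/= bx cx _] _] C]]] := metric_center_pair x.
by rewrite pendant_center => h; apply: (gate C); apply: h.
Qed.

Lemma dist_via_center x y : x != y ->
  dist_on x y = p x + d1 (metric_center x) (val y).
Proof.
move=> xy; apply: center_geodesic => w wx; have [->|wy] := eqVneq w y.
  have := pendant_add_le xy; have := d1_ge0 (val y) (metric_center y).
  rewrite -pendant_center /gromov d1xx /dist_on.
  by move: (p x) (p y) => px py; lra.
by apply: (@pendant_le _ _ (@dist_on R X)); rewrite /admissible /= wx eq_sym xy.
Qed.

(** The center of x is fed to the gate property at y.  A point w other than x
    and y is handled by minimality of the pendant length of y for the pair w, x;
    for w = x, what is needed is exactly pendant_add_le. *)
Lemma dist_via_centers x y : x != y ->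
  dist_on x y = p x + d1 (metric_center x) (metric_center y) + p y.
Proof.
move=> xy; have exy := dist_via_center xy.
have sum_le := pendant_add_le xy; rewrite exy in sum_le.
have -> : d1 (metric_center x) (metric_center y) =
    d1 (metric_center x) (val y) - p y.
  rewrite d1_sym [in RHS]d1_sym (@center_geodesic y) => [|w wy].
    by rewrite addrAC subrr add0r.
  have [->|wx] := eqVneq w x.
    have := pendant_center x; move: exy sum_le.
    rewrite /gromov /dist_on (d1_sym (val y) (val x)) (d1_sym (val y)) => -> + <-.
    by move: (p x) (p y) (d1 _ _) => px py dy; lra.
  have exw : dist_on x w = p x + d1 (metric_center x) (val w).
    by apply: dist_via_center; rewrite eq_sym.
  have : p y <= gromov (@dist_on R X) y w x.
    by apply: pendant_le; rewrite /admissible /= wy xy wx.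
  rewrite /gromov (dist_on_sym y x) (dist_on_sym w x) {}exy {}exw /dist_on.
  rewrite {sum_le} !(d1_sym _ (metric_center x)).
  move: (p x) (p y) (d1 (metric_center x) (val y)) (d1 (metric_center x) (val w)).
  by move=> px py d d'; lra.
by rewrite {}exy {sum_le}; move: (p x) (p y) (d1 _ _) => px py d; lra.
Qed.

End ThreePoints.

Lemma metric_center_small x y : (#|{: X}| <= 2)%N ->
  metric_center x = metric_center y.
Proof.
have [-> //|xy] := eqVneq x y.
have := metric_centerP x; have := metric_centerP y; rewrite /is_metric_center.
case E : #|_| => [|[|[|n]]] //.
- by have := fintype0 x; rewrite E.
- have /card_le1P : (#|{: X}| <= 1)%N by rewrite E.
  move=> /(_ x isT y); rewrite !inE => /esym/eqP yx.
  by rewrite yx eqxx in xy.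
- have other u v w : u != v -> w != v -> w = u.
    move=> uv wv; apply/eqP/negPn/negP => wu.
    suff : (2 < #|{: X}|)%N by rewrite E.
    by apply/card_gt2P; exists u, v, w; rewrite !inE uv wu (eq_sym v) wv.
  have yx : y != x by rewrite eq_sym.
  move=> [b by_ ->] [c cx ->] _; rewrite (other _ _ _ xy by_) (other _ _ _ yx cx).
  by rewrite addrC [X in (_, X / _)]addrC.
Qed.

Lemma trim_class_center x y :
  (trim_class (@dist_on R X) x == trim_class (@dist_on R X) y) =
  (metric_center x == metric_center y).
Proof.
rewrite (trim_classE dist_on_sym) /trim_rel.
have [X2|X3] := leqP #|{: X}| 2.
  by rewrite (metric_center_small x y X2) eqxx.
have [->|xy] := eqVneq x y; first by rewrite eqxx.
rewrite (dist_via_centers X3 xy); apply/eqP/eqP => [h|->].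
  apply: d1_eq0; move: h.
  by move: (p x) (p y) (d1 _ _) => px py d; lra.
by rewrite d1xx addr0.
Qed.

Lemma trim_dist_center x y :
  trim_dist (@dist_on R X) (trim_class (@dist_on R X) x)
    (trim_class (@dist_on R X) y) = d1 (metric_center x) (metric_center y).
Proof.
have [h|nxy] := eqVneq (trim_class (@dist_on R X) x)
                       (trim_class (@dist_on R X) y).
  have /eqP -> : metric_center x == metric_center y.
    by rewrite -trim_class_center h.
  by rewrite d1xx /trim_dist h eqxx.
rewrite (trim_dist_class dist_on_sym nxy).
move: nxy; rewrite (trim_classE dist_on_sym) /trim_rel !negb_or -ltnNge.
case/and3P=> X3 xy _; rewrite (dist_via_centers X3 xy).
by move: (p x) (p y) (d1 _ _) => px py d; lra.
Qed.

End MetricCenterOfSet.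

Theorem theorem1 (R : realType) (X : {fset R * R}) (hX : X != fset0) :
  exists f : {set X} -> R * R,
    (forall x : X, f (trim_class (@dist_on R X) x) = metric_center x) /\
    metric_isometry [set` trimming (@dist_on R X)]%classic (trim_dist (@dist_on R X))
             (metric_center_set X) (@d1 R) f.
Proof.
have [f fE] : exists f : {set X} -> R * R,
    forall x, f (trim_class (@dist_on R X) x) = metric_center x.
  exists (fun C : {set X} =>
    if [pick x in C] is Some x then metric_center x else (0, 0)).
  move=> x; case: pickP => [y|/(_ x)]; rewrite inE.
    by rewrite -(trim_classE (@dist_on_sym R X)) trim_class_center => /eqP/esym.
  by rewrite /trim_rel eqxx orbT.
have fP C : C \in trimming (@dist_on R X) ->
    exists2 x, C = trim_class (@dist_on R X) x & f C = metric_center x.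
  by move=> /imsetP[x _ ->]; exists x.
exists f; split=> //; split; first split.
- by move=> C /fP[x _ ->]; exists x.
- move=> C D /set_mem/fP[x CE fC] /set_mem/fP[y DE fD]; rewrite fC fD => /eqP.
  by rewrite -trim_class_center CE DE => /eqP.
- move=> _ [x _ <-]; exists (trim_class (@dist_on R X) x); last exact: fE.
  by apply/imsetP; exists x.
- by move=> C D /fP[x CE ->] /fP[y DE ->]; rewrite CE DE trim_dist_center.
Qed.
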